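(* Let $I=(a,b)\subset\mathbb{R}$ be an open and bounded interval, and let $u:I\to\mathbb{R}$. Then the following statements are equivalent: (a) $u$ is $\infty$-regulated, i.e. $u\in L^1(I)$ and $(\varepsilon,\infty)\text{-}\mathrm{Var}\,u<\infty$ for each $\varepsilon>0$. (b) $u$ can be realized as an $L^\infty$-limit of step functions on $I$, i.e. there is a sequence $(u_n)$ of step functions on $I$ with $\|u-u_n\|_\infty\to0$. (c) $u$ has a regulated version, i.e. there exists a regulated function $\bar u$ on $I$ with $\bar u(x)=u(x)$ for almost all $x\in I$.
   Context: ''Measurable'' and ''almost all'' refer to Lebesgue measure, and $\|\cdot\|_\infty$ is the $L^\infty(I)$-norm (essential supremum). Variation: for $v\in L^1(I)$, $\mathrm{Var}\,v:=\sup\{\int_I v\,\varphi'\,dx\mid \varphi\in C_c^1(I),\ \|\varphi\|_\infty\le1\}$, and $BV(I):=\{v\in L^1(I)\mid\mathrm{Var}\,v<\infty\}$. $(\varepsilon,\infty)$-variation: for $u\in L^1(I)$ and $\varepsilon>0$, $(\varepsilon,\infty)\text{-}\mathrm{Var}\,u:=\inf\{\mathrm{Var}\,v\mid v\in BV(I),\ \|u-v\|_\infty\le\varepsilon\}$, with the infimum over the empty set being $\infty$. Step function on $I$: a bounded function $w:I\to\mathbb{R}$ for which there are finitely many points $a=x_0<x_1<\dots<x_{m-1}<x_m=b$ such that $w$ is constant on each open interval $(x_i,x_{i+1})$, $i=0,\dots,m-1$ (values at the points $x_i$ are arbitrary). Regulated function on $I$: a bounded function $\bar u:I\to\mathbb{R}$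 (bounded everywhere, $\sup_{x\in I}|\bar u(x)|<\infty$) whose right and left limits exist as finite numbers at all points of $I$, and which has a finite right limit at $a$ and a finite left limit at $b$. *)

(* Defs.v *)
From HB Require Import structures.
From mathcomp Require Import all_boot all_order all_algebra.
From mathcomp Require Import all_classical all_reals all_analysis.

Set Implicit Arguments.
Unset Strict Implicit.
Unset Printing Implicit Defensive.

Import Order.TTheory GRing.Theory Num.Theory.
Import numFieldNormedType.Exports.

Local Open Scope classical_set_scope.
Local Open Scope ring_scope.

(* A function on ]a, b[ is represented by a total function R -> R; apart
   from the test functions of [Cc1], only its values on ]a, b[ matter below.

   The measure is the completed one: [lebesgue_measure] lives on the Borel
   sigma-algebra, so that a function almost everywhere equal to an integrable
   one need not be integrable for it. *)
Notation leb R := (@completed_lebesgue_measure R).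

Section infinity_regulated.
Context {R : realType}.
Implicit Types (a b e : R) (u v w phi : R -> R).

Definition L1 a b : set (R -> R) :=
  [set v | (leb R).-integrable `]a, b[ (EFin \o v)].

(* The extension by 0 outside ]a, b[ does not change the essential supremum of
   the absolute value. *)
Definition Linfty_norm a b v : \bar R :=
  'N[leb R]_+oo%E [EFin \o (v \_ `]a, b[)].

(* C_c^1(]a, b[), its elements being extended by 0 to the whole line *)
Definition Cc1 a b : set (R -> R) :=
  [set phi : R -> R |
    [/\ forall x : R, derivable phi x 1,
        continuous phi^`()%classic,
        compact (closure [set x | phi x != 0])
      & closure [set x | phi x != 0] `<=` `]a, b[ ] ].

Definition Var a b v : \bar R :=
  ereal_sup [set (\int[leb R]_(x in `]a, b[) (v x * phi^`()%classic x)%:E)%E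
            | phi in [set phi | Cc1 a b phi /\ (Linfty_norm a b phi <= 1)%E]].

Definition BV a b : set (R -> R) :=
  [set v | L1 a b v /\ (Var a b v < +oo)%E].

Definition eps_infty_Var a b e u : \bar R :=
  ereal_inf [set Var a b v
            | v in [set v | BV a b v /\ (Linfty_norm a b (u \- v)%R <= e%:E)%E]].

Definition infty_regulated a b u :=
  L1 a b u /\ forall e, 0 < e -> (eps_infty_Var a b e u < +oo)%E.

Definition bounded_on_itv a b w :=
  exists M, forall x, x \in `]a, b[ -> `|w x| <= M.

(* [itv_partition a b s] states that a :: s is strictly increasing and ends
   with b, so that a :: s lists the points x_0 = a, x_1, up to x_m = b. *)
Definition step_function a b w :=
  bounded_on_itv a b w /\
  exists s : seq R, itv_partition a b s /\
    forall i, (i < size s)%N -> exists c, forall x,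
      x \in `]nth b (a :: s) i, nth b (a :: s) i.+1[ -> w x = c.

Definition regulated a b w :=
  [/\ bounded_on_itv a b w,
      forall x, x \in `]a, b[ -> cvg (w @ x^'+) /\ cvg (w @ x^'-),
      cvg (w @ a^'+)
    & cvg (w @ b^'-)].

Definition step_limit a b u :=
  exists un : nat -> R -> R,
    (forall n, step_function a b (un n)) /\
    Linfty_norm a b (u \- un n) @[n --> \oo] --> 0%E.

Definition has_regulated_version a b u :=
  exists ubar : R -> R, regulated a b ubar /\
    \forall x \ae leb R, x \in `]a, b[ -> ubar x = u x.

End infinity_regulated.

(* Main.v *)
(* All three conditions are equivalent to: there is a co-null L in ]a, b[ such
   that, along L, the function u is Cauchy at every one-sided limit point of
   [a, b]. This property is stable under L^oo limits and trivial for step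
   functions. It holds for v of bounded variation with L the Lebesgue points of
   v: testing with a smoothing of the signed indicators of disjoint intervals
   [p_i, q_i] with endpoints in L gives \sum_i |v(p_i) - v(q_i)| <= Var v,
   which forbids infinitely many jumps larger than e near a point.
   Conversely, u is completed outside L by its right limits along L; the
   resulting regulated function is uniformly approximated by step functions
   through an infimum argument, and step functions have finite variation. *)
Require Import Defs.
From HB Require Import structures.
From mathcomp Require Import all_boot all_order all_algebra.
From mathcomp Require Import all_classical all_reals all_analysis.
From mathcomp Require Import measurable_realfun ess_sup_inf.
From mathcomp Require Import lra.
Import Order.TTheory GRing.Theory Num.Theory.
Import numFieldNormedType.Exports.
Local Open Scope classical_set_scope.
Local Open Scope ring_scope.
Set Implicit Arguments.
Unset Strict Implicit.
Unset Printing Implicit Defensive.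

(* the carrier of the completed Lebesgue measure: R with the Caratheodory
   sigma-algebra *)
Local Notation lebT R := (caratheodory_type (wlength (@idfun R))^*%mu).

(** * Transfer between the completed Lebesgue measure and the Borel one *)

Section completed_measure.
Context {R : realType}.
Local Notation mu := (@lebesgue_measure R).

Lemma leb_measurable (A : set R) :
  measurable A ->
  (wlength (@idfun R))^*%mu.-cara.-measurable A.
Proof. exact: sub_caratheodory. Qed.

Lemma leb_measurable_fun d (T : measurableType d) (D : set R) (f : R -> T) :
  measurable D ->
  measurable_fun D f ->
  measurable_fun (D : set (lebT R)) f.
Proof. by move=> mD mf _ Y mY; apply: leb_measurable; exact: mf. Qed.

Lemma leb_negligible (N : set R) :
  mu.-negligible N -> (leb R).-negligible N.
Proof.
by move=> [A [mA A0 NA]]; exists A; split => //; exact: leb_measurable.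
Qed.

(** The identity is measurable from the Caratheodory sigma-algebra to the smaller Borel one and
    pushes the completed measure to [mu], so this is a change of variables. *)
Lemma ge0_leb_integral (D : set R) (f : R -> \bar R) :
  measurable D ->
  measurable_fun D f ->
  {in D, forall x, (0 <= f x)%E} ->
  (\int[leb R]_(x in D) f x = \int[mu]_(x in D) f x)%E.
Proof.
move=> mD mf f0.
have mid : measurable_fun [set: caratheodory_type (wlength (@idfun R))^*%mu]
    (@idfun R : _ -> measurableTypeR R).
  by move=> _ Y mY; rewrite setTI; exact: leb_measurable.
have := @ge0_integral_pushforward _ _ _ _ R _ mid (leb R) D f mD mf f0.
move=> /esym.
rewrite preimage_id => ->.
by apply: eq_measure_integral.
Qed.

Lemma leb_integral (D : set R) (f : R -> \bar R) :
  measurable D ->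
  measurable_fun D f ->
  (\int[leb R]_(x in D) f x = \int[mu]_(x in D) f x)%E.
Proof.
move=> mD mf; rewrite [LHS]integralE [RHS]integralE.
rewrite !ge0_leb_integral//.
- exact: measurable_funeneg.
- exact: measurable_funepos.
Qed.

Lemma leb_integrable (D : set R) (f : R -> \bar R) :
  measurable D ->
  measurable_fun D f ->
  (leb R).-integrable D f <-> mu.-integrable D f.
Proof.
move=> mD mf; split => /integrableP[_ H]; apply/integrableP; split => //.
- rewrite -ge0_leb_integral//.
  exact: measurableT_comp.
- exact: leb_measurable_fun.
- rewrite ge0_leb_integral//.
  exact: measurableT_comp.
Qed.

End completed_measure.

(** * Borel representatives of Lebesgue measurable functions *)

Section borel_representative.
Context {R : realType}.
Local Notation mu := (@lebesgue_measure R).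

(** The Caratheodory sigma-algebra is the completion of the Borel one, so A is a Borel set enlarged
    by a part of a Borel null set. *)
Lemma leb_measurable_decomp (A : set R) :
  (wlength (@idfun R))^*%mu.-cara.-measurable A ->
  exists B M : set R, [/\ measurable B, measurable M, mu M = 0%E,
    B `<=` A & A `<=` B `|` M].
Proof.
rewrite -completed_caratheodory_measurable g_sigma_completed_algebra_genE.
move=> [B mB [N [M [mM M0 NM]] <-]].
exists B, M; split => //.
exact: setUS.
Qed.

(** The sublevel sets of v at rational heights become Borel once a single Borel null set N, the
    union of their exceptional sets, is removed. Setting the function to 0 on N and outside D makes
    it Borel on the whole line. *)
Lemma borel_representative (D : set R) (v : R -> R) : measurable D ->
  measurable_fun (D : set (lebT R)) v ->
  exists w : R -> R, [/\ measurable_fun setT w, {in ~` D, w =1 cst 0}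
    & {ae leb R, forall x, D x -> w x = v x}].
Proof.
move=> mD mv.
(* for each rational q, {v < q} is Borel up to a null set M q *)
pose A (q : rat) := D `&` [set x | v x < ratr q].
have /choice[B /choice[M HBM]] q : exists B M : set R,
    [/\ measurable B, measurable M, mu M = 0%E, B `<=` A q & A q `<=` B `|` M].
  apply: leb_measurable_decomp.
  have := mv (leb_measurable mD) `]-oo, (ratr q)[%classic (measurable_itv _).
  congr (_ _); apply/seteqP; split => x; rewrite /A/= in_itv/=; exact.
have mB q : measurable (B q) by have [] := HBM q.
have mM q : measurable (M q) by have [] := HBM q.
pose N := \bigcup_q M q.
have mN : measurable N by exact: bigcupT_measurable_rat.
pose w := v \_ (D `\` N).
exists w; split.
- apply: (measurability _ (RGenInftyO.measurableE R)) => _ [_ [r ->] <-].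
  (* A value is below r exactly when it is below some rational q < r. The set where w is 0 by
     default joins the sublevel set of q as soon as q > 0. *)
  rewrite setTI (_ : _ @^-1` _ = \bigcup_(q : rat) (if ratr q < r then
      ((B q `\` N) `|` (if (0 : R) < ratr q then ~` (D `\` N) else set0))
      else set0)); last first.
    apply/seteqP; split => x /=; rewrite in_itv/=.
      move=> /rat_in_itvoo[q]; rewrite in_itv/= => /andP[wq qr].
      exists q => //; rewrite qr; move: wq; rewrite /w patchE.
      case: ifPn => [|/negP]; rewrite inE => xDN.
        move=> vq; left; split; last exact: xDN.2.
        have [_ _ _ _ /(_ x)] := HBM q; case => //; first by split => //; exact: xDN.1.
        by move=> Mx; exfalso; apply: xDN.2; exists q.
      by move=> q0; right; rewrite q0.
    move=> [q _]; case: ifPn => // qr [[Bx Nx]|].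
      have [_ _ _ /(_ x Bx)[Dx vx] _] := HBM q.
      by rewrite /w patchE mem_set//; exact: lt_trans qr.
    case: ifPn => // q0 xDN.
    by rewrite /w patchE memNset//; exact: lt_trans qr.
  apply: bigcupT_measurable_rat => q; case: ifPn => // _.
  apply: measurableU; first exact: measurableD.
  by case: ifPn => // _; apply: measurableC; exact: measurableD.
- move=> x; rewrite inE => Dx; rewrite /w patchE memNset//.
  by move=> [].
- have N0 : mu.-negligible N.
    (* The union over the rationals is reindexed by [nat]; numbers that encode no rational
       contribute the empty set. *)
    pose F (i : nat) : set R := oapp M set0 (unpickle i).
    have FE q : F (pickle q) = M q by rewrite /F pickleK.
    have NF : N `<=` \bigcup_i F i.
      by move=> x [q _ Mx]; exists (pickle q); [exact: I|rewrite FE].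
    have nF : mu.-negligible (\bigcup_i F i).
      apply: negligible_bigcup => i; rewrite /F.
      case: unpickle => [q|]; last exact: negligible_set0.
      by exists (M q); split => //; have [] := HBM q.
    exact: (@negligibleS _ _ _ mu _ _ NF nF).
  apply: (@negligibleS _ _ _ (leb R) _ _ _ (leb_negligible N0)) => x /= H.
  apply: contrapT => Nx; apply: H => Dx.
  by rewrite /w patchE mem_set.
Qed.

End borel_representative.

(** * Co-null sets and the essential supremum norm *)

Section conull.
Context {R : realType}.
Local Notation mu := (@lebesgue_measure R).

Lemma leb_ae_filter : Filter (almost_everywhere (leb R)).
Proof. exact: (@ae_filter_ringOfSetsType _ _ _ (leb R)). Qed.

(** Otherwise an interval of positive length would lie inside a null set. *)
Lemma conull_itvoo (a b c d : R) (L : set R) :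
  (\forall x \ae leb R, x \in `]a, b[ -> L x) ->
  a <= c -> c < d -> d <= b -> exists2 x, x \in `]c, d[ & L x.
Proof.
move=> [N [mN N0 LN]] ac cd db; apply: contrapT => H.
have cdN : `]c, d[%classic `<=` N.
  move=> x xcd; apply: LN => /= Lx; apply: H; exists x => //; apply: Lx.
  by apply: subset_itv xcd; rewrite bnd_simp.
have : (leb R `]c, d[%classic <= leb R N)%E.
  apply: le_measure => //; rewrite inE; last exact: mN.
  exact: leb_measurable (measurable_itv _).
rewrite N0 (_ : leb R `]c, d[%classic = mu `]c, d[%classic)//.
by rewrite lebesgue_measure_itv/= lte_fin cd -EFinB lee_fin leNgt subr_gt0 cd.
Qed.

Lemma Linfty_norm_leP (a b : R) (f : R -> R) (e : R) : 0 <= e ->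
  (Linfty_norm a b f <= e%:E)%E <->
  \forall x \ae leb R, x \in `]a, b[ -> `|f x| <= e.
Proof.
(* The norm of exponent +oo unfolds to an essential supremum when the whole space has positive
   measure. Outside []a, b[] the extended function is 0, where the bound reads 0 <= e. *)
move=> e0; rewrite /Linfty_norm unlock ifT; last first.
  change (0 < mu [set: R])%E.
  rewrite -set_itvNyy lebesgue_measure_itv/=.
  by rewrite addye ?ltry.
split.
  move=> /ess_supP; apply: (@filterS _ _ leb_ae_filter) => x /= + xab.
  by rewrite patchE mem_set.
move=> H; apply/ess_supP; move: H; apply: (@filterS _ _ leb_ae_filter) => x /=.
rewrite patchE; case: ifPn => [|_ _]; first by rewrite inE => xab; exact.
by rewrite normr0 lee_fin.
Qed.

End conull.

(** * A C^1 ramp from 0 to 1 and its derivative *)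

Section ramp.
Context {R : realType}.
Implicit Types t x : R.

(* [tent t] is max 0 (1 - |t|), written so that its primitive [ramp] only
   involves t |t|. *)
Definition tent t : R := (`|t + 1| - 2 * `|t| + `|t - 1|) / 2.

Definition ramp t : R :=
  1 / 2 + ((t + 1) * `|t + 1| - 2 * (t * `|t|) + (t - 1) * `|t - 1|) / 4.

Lemma is_derive_mul_norm x : is_derive x 1 (fun t : R => t * `|t|) (2 * `|x|).
Proof.
have [x0|x0|->] := ltgtP x 0.
- apply: (@near_eq_is_derive _ _ _ (fun t : R => - (t * t))).
    near=> t; rewrite ltr0_norm ?mulrN//; near: t.
    exact: lt_nbhsl.
  rewrite ltr0_norm//; apply: is_derive_eq; rewrite /GRing.scale/=; lra.
- apply: (@near_eq_is_derive _ _ _ (fun t : R => t * t)).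
    near=> t; rewrite gtr0_norm//; near: t.
    exact: lt_nbhsr.
  rewrite gtr0_norm//; apply: is_derive_eq; rewrite /GRing.scale/=; lra.
(* At 0 the slope function of t |t| is |t|, which is continuous and vanishes there. *)
- rewrite normr0 mulr0; apply/is_derive1_caratheodory.
  exists (fun t => `|t|); split => //; last by rewrite normr0.
  + by move=> z; rewrite normr0 mulr0 !subr0 mulrC.
  + exact: norm_continuous.
Unshelve. all: by end_near. Qed.

Lemma is_derive_ramp x : is_derive x 1 ramp (tent x).
Proof.
have D c : is_derive x 1 (fun t : R => (t + c) * `|t + c|) (2 * `|x + c|).
  have := @is_derive1_comp _ (fun t : R => t * `|t|) (fun t => t + c) x _ 1
    (is_derive_mul_norm (x + c)).
  by rewrite mulr1; apply; apply: is_derive_eq; rewrite addr0.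
have D1 := D 1; have D2 := D (- 1); have D0 := is_derive_mul_norm x.
rewrite /ramp; apply: is_derive_eq.
rewrite /GRing.scale/= /tent; lra.
Qed.

Lemma tent_continuous : continuous tent.
Proof.
move=> x; rewrite /tent; apply: cvgMl.
apply: cvgD; [apply: cvgB|].
- by apply: cvg_norm; apply: cvgD; [exact: cvg_id|exact: cvg_cst].
- by apply: cvgMr; exact: norm_continuous.
- by apply: cvg_norm; apply: cvgB; [exact: cvg_id|exact: cvg_cst].
Qed.

(** Splitting each absolute value by sign reduces the bounds below to polynomial arithmetic. *)
Let normE t : 0 <= t /\ `|t| = t \/ t < 0 /\ `|t| = - t.
Proof.
have [t0|t0] := leP 0 t; [left|right]; split => //.
  exact: ger0_norm. exact: ltr0_norm.
Qed.

Lemma tent_ge0 t : 0 <= tent t.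
Proof.
rewrite /tent; have := normE t; have := normE (t + 1); have := normE (t - 1).
by move=> [[? ->]|[? ->]] [[? ->]|[? ->]] [[? ->]|[? ->]]; lra.
Qed.

Lemma tent_le1 t : tent t <= 1.
Proof.
rewrite /tent; have := normE t; have := normE (t + 1); have := normE (t - 1).
by move=> [[? ->]|[? ->]] [[? ->]|[? ->]] [[? ->]|[? ->]]; lra.
Qed.

Lemma tent_out t : 1 <= `|t| -> tent t = 0.
Proof.
rewrite /tent; have := normE t; have := normE (t + 1); have := normE (t - 1).
by move=> [[? ->]|[? ->]] [[? ->]|[? ->]] [[? ->]|[? ->]]; lra.
Qed.

Lemma ramp_lt t : t <= - 1 -> ramp t = 0.
Proof.
move=> t1; rewrite /ramp !ler0_norm; [lra|lra|lra|lra].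
Qed.

Lemma ramp_gt t : 1 <= t -> ramp t = 1.
Proof.
move=> t1; rewrite /ramp !ger0_norm; [lra|lra|lra|lra].
Qed.

Lemma ramp_itv t : 0 <= ramp t <= 1.
Proof.
have [t1|t1] := leP t (- 1); first by rewrite ramp_lt// lexx ler01.
have [t2|t2] := leP 1 t; first by rewrite ramp_gt// lexx ler01.
rewrite /ramp (gtr0_norm (_ : 0 < t + 1)) ?(ltr0_norm (_ : t - 1 < 0)); [|lra|lra].
have := normE t; move=> [[? ->]|[? ->]]; nra.
Qed.

End ramp.

(** * Rescaled tents as an approximate identity at Lebesgue points *)

Section kernel.
Context {R : realType}.
Local Notation mu := (@lebesgue_measure R).
Implicit Types h p q t x : R.

(** For h > 0 and p < q, a C^1 smoothing of the indicator of [p, q] at scale h, vanishing outside ]p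
    - h, q + h[. *)
Definition bump h p q t : R := ramp ((t - p) / h) - ramp ((t - q) / h).

(** The derivative of the rescaled ramp, concentrating at p as h tends to 0. *)
Definition kern h p t : R := tent ((t - p) / h) / h.

Lemma is_derive_rampZ h p x : is_derive x 1 (fun t => ramp ((t - p) / h)) (kern h p x).
Proof.
have := @is_derive1_comp _ (@ramp R) (fun t : R => (t - p) / h) x _ h^-1
  (is_derive_ramp ((x - p) / h)).
apply; apply: is_derive_eq.
rewrite /GRing.scale/=; lra.
Qed.

Lemma is_derive_bump h p q x :
  is_derive x 1 (bump h p q) (kern h p x - kern h q x).
Proof.
have := is_derive_rampZ h p x; have := is_derive_rampZ h q x.
by move=> ? ?; rewrite /bump; apply: is_derive_eq.
Qed.

Lemma kern_continuous h p : continuous (kern h p).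
Proof.
move=> x; rewrite /kern; apply: cvgMl.
apply: (@cvg_comp _ _ _ (fun t => (t - p) / h) (@tent R)); last exact: tent_continuous.
by apply: cvgMl; apply: cvgB; [exact: cvg_id|exact: cvg_cst].
Qed.

Lemma kern_ge0 h p t : 0 < h -> 0 <= kern h p t.
Proof. by move=> h0; rewrite divr_ge0 ?tent_ge0// ltW. Qed.

Lemma kern_le h p t : 0 < h -> kern h p t <= h^-1.
Proof. by move=> h0; rewrite ler_piMl ?tent_le1// invr_ge0 ltW. Qed.

Lemma kern_out h p t : 0 < h -> h <= `|t - p| -> kern h p t = 0.
Proof.
move=> h0 tp; rewrite /kern tent_out ?mul0r//.
by rewrite normrM normfV (gtr0_norm h0) ler_pdivlMr// mul1r.
Qed.

Lemma bump_le1 h p q t : `|bump h p q t| <= 1.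
Proof.
have /andP[? ?] := ramp_itv ((t - p) / h).
have /andP[? ?] := ramp_itv ((t - q) / h).
by rewrite ler_norml /bump; apply/andP; split; lra.
Qed.

Lemma bump_out h p q t : 0 < h -> p < q -> bump h p q t != 0 ->
  p - h < t < q + h.
Proof.
move=> h0 pq; apply: contraNT; rewrite negb_and -!leNgt /bump => /orP[] H.
  rewrite !ramp_lt ?subrr//.
    by rewrite ler_pdivrMr//; lra.
  by rewrite ler_pdivrMr//; lra.
rewrite !ramp_gt ?subrr//.
  by rewrite ler_pdivlMr//; lra.
by rewrite ler_pdivlMr//; lra.
Qed.

Lemma kern_integrable h p (D : set R) w : measurable D -> 0 < h ->
  mu.-integrable D (EFin \o w) ->
  mu.-integrable D (EFin \o (fun x => w x * kern h p x)).
Proof.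
move=> mD h0 iw.
apply: (@integrableMl _ _ _ mu D mD (EFin \o w) (kern h p)) => //.
  by apply: measurable_funTS; apply: continuous_measurable_fun; exact: kern_continuous.
exists h^-1; split; first exact: num_real.
move=> M hM x Dx /=; rewrite ger0_norm ?kern_ge0//.
by rewrite (le_trans (kern_le _ _ h0))// ltW.
Qed.

(** The rescaled ramp is a primitive, and it rises from 0 to 1 across the ball. *)
Lemma Rintegral_kern h p : 0 < h -> \int[mu]_(x in ball p h) kern h p x = 1.
Proof.
move=> h0; have ph : p - h < p + h by lra.
have ck := @kern_continuous h p.
have ikern (D : set R) : D `<=` `[p - h, p + h] -> measurable D ->
    mu.-integrable D (EFin \o kern h p).
  move=> Dph mD; apply: (@integrableS _ _ _ mu `[p - h, p + h]) => //.
  apply: continuous_compact_integrable; first exact: segment_compact.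
  exact: continuous_subspaceT.
rewrite ball_itv Rintegral_itv_bndo_bndc; last first.
  by apply: ikern => //; exact: subset_itv_oo_cc.
rewrite Rintegral_itv_obnd_cbnd; last first.
  by apply: ikern => //; exact: subset_itv_oc_cc.
pose F := fun t => ramp ((t - p) / h).
have dF x : is_derive x 1 F (kern h p x) := is_derive_rampZ h p x.
have cF : continuous F.
  by move=> x; apply/differentiable_continuous/derivable1_diffP; have [] := dF x.
rewrite /Rintegral (continuous_FTC2 (F := F) ph).
- rewrite /F /= ramp_gt; last by rewrite ler_pdivlMr//; lra.
  rewrite ramp_lt ?subr0//; last by rewrite ler_pdivrMr//; lra.
- exact: continuous_subspaceT.
- split.
  + by move=> x _; have [] := dF x.
  + by apply: cvg_at_right_filter; exact: cF.
  + by apply: cvg_at_left_filter; exact: cF.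
- by move=> x _; rewrite derive1E; have [_ ->] := dF x.
Qed.

(** The kernel has mass 1, vanishes off [ball p h] and is at most 1 / h. The error is thus at most 1
    / h times the integral of |w - w p| over a ball of length 2 h, that is twice the mean deviation
    [davg], which tends to 0 at a Lebesgue point. *)
Lemma kern_cvg w p : mu.-integrable setT (EFin \o w) -> lebesgue_pt w p ->
  \int[mu]_x (w x * kern h p x) @[h --> 0^'+] --> w p.
Proof.
move=> iw /fine_cvgP[fdavg cdavg].
apply/cvgrPdist_le => e e0.
have e2 : 0 < e / 2 by rewrite divr_gt0.
near=> h.
have h0 : 0 < h by near: h; exact: nbhs_right_gt.
have fin : davg w p h \is a fin_num by near: h; exact: fdavg.
have Hd : fine (davg w p h) <= e / 2.
  rewrite -[leLHS]ger0_norm; last exact/fine_ge0/davg_ge0.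
  rewrite -normrN -[X in `|X|]add0r.
  by near: h; move/cvgrPdist_le : cdavg => /(_ _ e2); exact.
have mB : measurable (ball p h) := measurable_ball p h.
have iwB : mu.-integrable (ball p h) (EFin \o w) by exact: integrableS iw.
have muB : mu (ball p h) = (h *+ 2)%:E by rewrite lebesgue_measure_ball// ltW.
have icst c : mu.-integrable (ball p h) (EFin \o cst c).
  apply: (@measurable_bounded_integrable _ _ _ mu) => //.
    by change (mu (ball p h) < +oo)%E; rewrite muB ltry.
  by exists `|c|; split => // M cM x _; exact: ltW.
have iwp : mu.-integrable (ball p h) (EFin \o (fun x => w x - w p)).
  by have := @integrableB _ _ _ mu _ mB _ _ iwB (icst (w p)).
have -> : \int[mu]_x (w x * kern h p x) = \int[mu]_(x in ball p h) (w x * kern h p x).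
  rewrite [RHS]Rintegral_mkcond; apply: eq_Rintegral => x _.
  rewrite patchE; case: ifPn => // /negP; rewrite inE => xB.
  rewrite kern_out ?mulr0//; rewrite leNgt; apply/negP => xp; apply: xB.
  by rewrite -ball_normE /ball_/= distrC.
rewrite -[w p](mulr1) -(Rintegral_kern p h0) -RintegralZl//; last first.
  rewrite (_ : EFin \o _ = EFin \o (fun x => 1 * kern h p x)); last first.
    by apply/funext => x /=; rewrite mul1r.
  exact: (kern_integrable p mB h0 (icst 1)).
rewrite distrC -RintegralB//; last 2 first.
- exact: kern_integrable.
- exact: (kern_integrable p mB h0 (icst (w p))).
apply: (@le_trans _ _ (\int[mu]_(x in ball p h) (`|w x - w p| * h^-1))).
  apply: le_trans.
    apply: le_normr_Rintegral => //.
    rewrite (_ : EFin \o _ = EFin \o (fun x => (w x - w p) * kern h p x)).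
      exact: kern_integrable.
    by apply/funext => x /=; rewrite mulrBl.
  apply: le_Rintegral => //.
  - apply: integrable_norm => //.
    rewrite (_ : EFin \o _ = EFin \o (fun x => (w x - w p) * kern h p x)).
      exact: kern_integrable.
    by apply/funext => x /=; rewrite mulrBl.
  - rewrite (_ : EFin \o _ = (fun x => `|w x - w p|%:E * (h^-1)%:E)%E)//.
    by apply: integrableZr => //; exact: (integrable_norm iwp).
  - move=> x _; rewrite -mulrBl normrM (ger0_norm (kern_ge0 _ _ h0)).
    by apply: ler_wpM2l => //; exact: kern_le.
rewrite RintegralZr//; last exact: (integrable_norm iwp).
have : fine (davg w p h) = (h *+ 2)^-1 * \int[mu]_(x in ball p h) `|w x - w p|.
  rewrite /davg /iavg muB inver mulrn_eq0/= gt_eqF// fineM//.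
  by apply: integrable_fin_num => //; exact: (integrable_norm iwp).
move=> E; move: Hd; rewrite E => Hd.
rewrite -mulr_natl invfM in Hd.
move: Hd; set I := Rintegral _ _ _; nra.
Unshelve. all: by end_near. Qed.

End kernel.

(** * Test functions built as signed sums of disjoint bumps *)

Section test_function.
Context {R : realType}.
Variables (n : nat) (s p q : 'I_n -> R) (h : R).

Definition bumps (t : R) : R := \sum_(i < n) s i * bump h (p i) (q i) t.

Lemma is_derive_bumps (x : R) : is_derive x 1 bumps
  (\sum_(i < n) s i * (kern h (p i) x - kern h (q i) x)).
Proof.
have -> : bumps = \sum_(i < n) (s i \*: bump h (p i) (q i)).
  by apply/funext => t; rewrite fct_sumE.
apply: is_derive_sum => i.
have := is_derive_bump h (p i) (q i) x; exact: is_deriveZ.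
Qed.

Hypotheses (h0 : 0 < h) (pq : forall i, p i < q i)
  (sep : forall i j, i != j -> q i + h <= p j - h \/ q j + h <= p i - h).

(** By [sep] the enlarged intervals ]p i - h, q i + h[ are disjoint, so at most one term of the sum
    is nonzero at t. *)
Lemma bumps_le1 t : (forall i, `|s i| <= 1) -> `|bumps t| <= 1.
Proof.
move=> s1.
have [[i bi]|H] := pselect (exists i, bump h (p i) (q i) t != 0); last first.
  rewrite /bumps big1 ?normr0// => i _.
  have [->|b0] := eqVneq (bump h (p i) (q i) t) 0; first by rewrite mulr0.
  by exfalso; apply: H; exists i.
rewrite /bumps (bigD1 i)//= big1 ?addr0.
  by rewrite normrM mulr_ile1 ?bump_le1.
move=> j ji; have [->|bj] := eqVneq (bump h (p j) (q j) t) 0.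
  by rewrite mulr0.
have /andP[? ?] := bump_out h0 (pq i) bi.
have /andP[? ?] := bump_out h0 (pq j) bj.
have [] := sep ji; lra.
Qed.

(** One h of the margin 2 h absorbs the enlargement of the intervals; the other keeps the closed
    support in [a + h, b - h], a compact part of the open interval. *)
Lemma bumps_Cc1 (a b : R) : (forall i, a + 2 * h <= p i) ->
  (forall i, q i + 2 * h <= b) -> Cc1 a b bumps.
Proof.
move=> ap qb.
have D x := is_derive_bumps x.
have sub : closure [set x | bumps x != 0] `<=` `[a + h, b - h].
  have -> : `[a + h, b - h]%classic = closure `[a + h, b - h].
    by apply/closure_id; exact: interval_closed.
  apply: closure_subset => x /=; rewrite in_itv/=; apply: contraR => Hx.
  rewrite /bumps big1// => i _.
  have [->|bi] := eqVneq (bump h (p i) (q i) x) 0; first by rewrite mulr0.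
  have /andP[? ?] := bump_out h0 (pq i) bi.
  by have ? := ap i; have ? := qb i; case/negP: Hx; apply/andP; split; lra.
split.
- by move=> x; have [] := D x.
- have -> : bumps^`()%classic =
      (fun x => \sum_(i < n) s i * (kern h (p i) x - kern h (q i) x)).
    by apply/funext => x; rewrite derive1E; have [_ ->] := D x.
  move=> x; apply: cvg_big => //; first exact: add_continuous.
  move=> i _; apply: cvgMr.
  by apply: cvgB; exact: kern_continuous.
- apply: (subclosed_compact _ (@segment_compact _ (a + h) (b - h))) => //.
  exact: closed_closure.
- by apply: (subset_trans sub); apply: subset_itv; rewrite bnd_simp; move: h0; lra.
Qed.

End test_function.

(** * Sums of jumps bounded by the variation *)

Section variation.
Context {R : realType}.
Local Notation mu := (@lebesgue_measure R).

Lemma leb_ae_eq_integral (D : set R) (f g : R -> \bar R) :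
  (wlength (@idfun R))^*%mu.-cara.-measurable D ->
  measurable_fun (D : set (lebT R)) f ->
  measurable_fun (D : set (lebT R)) g ->
  {ae leb R, forall x, D x -> f x = g x} ->
  (\int[leb R]_(x in D) f x = \int[leb R]_(x in D) g x)%E.
Proof. by move=> mD mf mg fg; exact: (@ae_eq_integral _ _ _ (leb R)). Qed.

(** An integrable Borel function on the whole line gives access to Lebesgue points with respect to
    [mu]. *)
Lemma L1_borel_representative (a b : R) (v : R -> R) : L1 a b v ->
  exists w : R -> R, [/\ mu.-integrable setT (EFin \o w),
    {in ~` `]a, b[, w =1 cst 0}
    & {ae leb R, forall x, x \in `]a, b[ -> w x = v x}].
Proof.
move=> /integrableP[mv iv].
have mI : measurable (`]a, b[ : set R) := measurable_itv _.
have cI := leb_measurable mI.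
have /measurable_EFinP mv' := mv.
have [w [mw w0 wv]] := borel_representative mI mv'.
exists w; split => //.
have mwI : measurable_fun (`]a, b[ : set R) (EFin \o w).
  by apply: measurable_funTS; exact/measurable_EFinP.
have iwI : mu.-integrable `]a, b[ (EFin \o w).
  apply/leb_integrable => //; apply/integrableP.
  split; first exact: leb_measurable_fun.
  apply: le_lt_trans iv; rewrite le_eqVlt; apply/orP; left; apply/eqP.
  apply: leb_ae_eq_integral.
  - exact: cI.
  - by apply: measurableT_comp => //; exact: leb_measurable_fun.
  - exact: measurableT_comp.
  - move: wv; apply: (@filterS _ _ leb_ae_filter) => x /= /[apply].
    by move=> ->.
have -> : EFin \o w = (EFin \o w) \_ `]a, b[.
  apply/funext => x /=; rewrite patchE; case: ifPn => // xI.
  by rewrite w0//= inE => xI'; case/negP: xI; rewrite inE.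
exact: (@integrable_mkcond _ _ _ mu _ _ mI).1.
Qed.

(** The derivative of a bump is a difference of two kernels. Once v is replaced by w, which vanishes
    off []a, b[], the integral extends to the line and linearity concludes. *)
Lemma integral_bumps (a b : R) (v w : R -> R) n (s p q : 'I_n -> R) (h : R) :
  0 < h -> L1 a b v -> mu.-integrable setT (EFin \o w) ->
  {in ~` `]a, b[, w =1 cst 0} ->
  {ae leb R, forall x, x \in `]a, b[ -> w x = v x} ->
  (\int[leb R]_(x in `]a, b[) (v x * (bumps s p q h)^`()%classic x)%:E =
   (\sum_(i < n) s i * (\int[mu]_t (w t * kern h (p i) t) -
                        \int[mu]_t (w t * kern h (q i) t)))%:E)%E.
Proof.
move=> h0 /integrableP[/measurable_EFinP mv _] iw w0 wv.
have mI : measurable (`]a, b[ : set R) := measurable_itv _.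
have cI := leb_measurable mI.
have mw : measurable_fun setT w.
  by apply/measurable_EFinP; exact: (@measurable_int _ _ _ mu _ _ iw).
have mk c : measurable_fun setT (kern h c).
  by apply: continuous_measurable_fun; exact: kern_continuous.
pose k t := \sum_(i < n) s i * (kern h (p i) t - kern h (q i) t).
have -> : (bumps s p q h)^`()%classic = k.
  by apply/funext => x; rewrite derive1E; have [_ ->] := is_derive_bumps s p q h x.
have mk' : measurable_fun setT k.
  apply: measurable_sum => i; apply: measurable_funM => //.
  exact: measurable_funB.
have mkI : measurable_fun (`]a, b[%classic : set (lebT R)) k.
  by apply: leb_measurable_fun => //; exact: measurable_funTS.
have mwI : measurable_fun (`]a, b[%classic : set (lebT R)) w.
  by apply: leb_measurable_fun => //; exact: measurable_funTS.
transitivity (\int[leb R]_(x in `]a, b[) (w x * k x)%:E)%E.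
  apply: leb_ae_eq_integral.
  - exact: cI.
  - by apply/measurable_EFinP; exact: measurable_funM.
  - by apply/measurable_EFinP; exact: measurable_funM.
  - move: wv; apply: (@filterS _ _ leb_ae_filter) => x /= /[apply].
    by move=> ->.
rewrite leb_integral//; last first.
  by apply/measurable_EFinP; apply: measurable_funTS; exact: measurable_funM.
rewrite integral_mkcond.
have iwk c : mu.-integrable setT (EFin \o (fun x => w x * kern h c x)).
  exact: kern_integrable.
transitivity (\int[mu]_x \sum_(i < n)
    (s i * (w x * kern h (p i) x - w x * kern h (q i) x))%:E)%E.
  apply: eq_integral => x _; rewrite patchE; case: ifPn => xI.
    rewrite sumEFin mulr_sumr; congr EFin; apply: eq_bigr => i _.
    by rewrite -mulrBr mulrCA.
  rewrite big1// => i _; rewrite w0 ?mul0r ?subrr ?mulr0//.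
  by rewrite inE => xI'; case/negP: xI; rewrite inE.
have iwB i : mu.-integrable setT
    (EFin \o (fun x => w x * kern h (p i) x - w x * kern h (q i) x)).
  by have := @integrableB _ _ _ mu _ measurableT _ _ (iwk (p i)) (iwk (q i)).
rewrite (@integral_sum _ _ _ mu _ measurableT _
  (fun i x => (s i * (w x * kern h (p i) x - w x * kern h (q i) x))%:E)); last first.
  by move=> i; exact: (@integrableZl _ _ _ mu _ measurableT (s i) _ (iwB i)).
rewrite -sumEFin; apply: eq_bigr => i _.
rewrite -RintegralB// -RintegralZl//.
rewrite /Rintegral fineK//; apply: integrable_fin_num => //.
exact: (@integrableZl _ _ _ mu _ measurableT (s i) _ (iwB i)).
Qed.

(** L consists of the Lebesgue points of the representative w at which w = v. For small h the bumps
    weighted by the signs of the jumps are admissible test functions, and by [kern_cvg] the tested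
    integrals tend to the sum of the |v (p i) - v (q i)|. *)
Lemma sum_jumps_le_Var (a b : R) (v : R -> R) : L1 a b v ->
  exists L : set R, (\forall x \ae leb R, x \in `]a, b[ -> L x) /\
  forall n (p q : 'I_n -> R),
    (forall i, [/\ a < p i, p i < q i, q i < b, L (p i) & L (q i)]) ->
    (forall i j, i != j -> q i < p j \/ q j < p i) ->
    ((\sum_(i < n) `|v (p i) - v (q i)|)%:E <= Var a b v)%E.
Proof.
move=> Lv; have [w [iw w0 wv]] := L1_borel_representative Lv.
have mI : measurable (`]a, b[ : set R) := measurable_itv _.
have cI := leb_measurable mI.
have mw : measurable_fun setT w.
  by apply/measurable_EFinP; exact: (@measurable_int _ _ _ mu _ _ iw).
have locw : locally_integrable setT w.
  by apply: open_integrable_locally => //; exact: openT.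
exists [set x | w x = v x /\ lebesgue_pt w x]; split.
  have H : (leb R).-negligible (~` [set x | lebesgue_pt w x]).
    by apply: leb_negligible; exact: (lebesgue_differentiation locw).
  move: wv; apply: (@filterS2 _ _ leb_ae_filter _ _ _ _ H) => x /= ? + xab.
  by move=> /(_ xab).
move=> n p q pqP sep.
pose s i := Num.sg (v (p i) - v (q i)).
pose K h x := \int[mu]_t (w t * kern h x t).
have cvgK : \sum_(i < n) s i * (K h (p i) - K h (q i)) @[h --> 0^'+] -->
    \sum_(i < n) `|v (p i) - v (q i)|.
  apply: cvg_big; first exact: add_continuous.
  move=> i _; have [_ _ _ [pw pL] [qw qL]] := pqP i.
  rewrite normrEsg -/(s i) -pw -qw.
  by apply: cvgMr; apply: cvgB; exact: kern_cvg.
have nearK : \forall h \near 0^'+,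
    ((\sum_(i < n) s i * (K h (p i) - K h (q i)))%:E <= Var a b v)%E.
  have near_le (P : 'I_n -> R) : (forall i, 0 < P i) ->
      \forall h \near 0^'+, forall i, h <= P i.
    by move=> P0; apply: filter_forall => i; exact: nbhs_right_le.
  near=> h.
  have h0 : 0 < h by near: h; exact: nbhs_right_gt.
  have ap : forall i, a + 2 * h <= p i.
    have : forall i, h <= (p i - a) / 2.
      near: h; apply: near_le => i.
      by rewrite divr_gt0// subr_gt0; have [] := pqP i.
    by move=> H i; have := H i; lra.
  have qb : forall i, q i + 2 * h <= b.
    have : forall i, h <= (b - q i) / 2.
      near: h; apply: near_le => i.
      by rewrite divr_gt0// subr_gt0; have [] := pqP i.
    by move=> H i; have := H i; lra.
  have pq i : p i < q i by have [] := pqP i.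
  have seph i j : i != j -> q i + h <= p j - h \/ q j + h <= p i - h.
    (* The default 1 keeps the bound on h positive for pairs in which interval i does not precede
       interval j. *)
    have : forall i j, h <= (if q i < p j then p j - q i else 1) / 2.
      near: h; apply: filter_forall => i; apply: near_le => j.
      by rewrite divr_gt0//; case: ifPn => // ?; rewrite subr_gt0.
    move=> H ij; have := H i j; have := H j i.
    by case: (sep i j ij) => -> /=; [left|right]; lra.
  have s1 i : `|s i| <= 1 by rewrite normr_sg; case: (_ != 0).
  pose phi := bumps s p q h.
  have -> : (\sum_(i < n) s i * (K h (p i) - K h (q i)))%:E =
      (\int[leb R]_(x in `]a, b[) (v x * phi^`()%classic x)%:E)%E.
    by rewrite (integral_bumps _ _ _ h0 Lv iw w0 wv).
  apply: ereal_sup_ubound; exists phi => //; split; first exact: bumps_Cc1.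
  apply/Linfty_norm_leP => //; apply: (@filterE _ _ leb_ae_filter) => x _.
  exact: bumps_le1.
pose J h := (\sum_(i < n) s i * (K h (p i) - K h (q i)))%:E.
have cvgJ : J h @[h --> 0^'+] --> (\sum_(i < n) `|v (p i) - v (q i)|)%:E.
  by apply: cvg_EFin => //; exact: nearW.
rewrite -(cvg_lim _ cvgJ)//; apply: lime_le => //; exact: cvgP cvgJ.
Unshelve. all: by end_near. Qed.

End variation.

(** * Oscillation along one-sided filters, restricted to co-null sets *)

Section one_sided_filters.
Context {R : realType}.
Implicit Types (a b c e : R) (F : set_system R) (L : set R) (u v w : R -> R).

(** All ways to approach a point of [a, b] from one side within ]a, b[. Quantifying over these
    filters treats left limits, right limits and both endpoints at once. *)
Definition one_sided a b F :=
  (exists2 c, a <= c < b & F = c^'+) \/ (exists2 c, a < c <= b & F = c^'-).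

Lemma one_sided_proper a b F : one_sided a b F -> ProperFilter F.
Proof. by move=> [] [c _ ->]; typeclasses eauto. Qed.

Lemma nbhs_right_itvoo c b (A : set R) : c < b -> c^'+ A ->
  exists d, [/\ c < d, d <= b & `]c, d[ `<=` A].
Proof.
move=> cb [e /= e0 eA]; exists (Num.min b (c + e)); split.
- by rewrite lt_min cb ltrDl.
- by rewrite ge_min lexx.
- move=> x /=; rewrite in_itv/= lt_min => /and3P[cx xb xe].
  by apply: eA => //=; rewrite ltr0_norm; lra.
Qed.

Lemma nbhs_left_itvoo a c (A : set R) : a < c -> c^'- A ->
  exists d, [/\ a <= d, d < c & `]d, c[ `<=` A].
Proof.
move=> ac [e /= e0 eA]; exists (Num.max a (c - e)); split.
- by rewrite le_max lexx.
- by rewrite gt_max ac ltrBlDr ltrDl.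
- move=> x /=; rewrite in_itv/= gt_max => /andP[/andP[ax ex] xc].
  by apply: eA => //=; rewrite gtr0_norm; lra.
Qed.

Lemma one_sided_itvoo a b F (A : set R) : one_sided a b F -> F A ->
  exists c d, [/\ a <= c, c < d, d <= b, F `]c, d[%classic & `]c, d[ `<=` A].
Proof.
move=> [] [c /andP[ac cb] ->] cA.
- have [d [cd db dA]] := nbhs_right_itvoo cb cA.
  exists c, d; split => //.
  near=> x; rewrite /= in_itv/=; apply/andP; split => //.
- have [d [ad dc dA]] := nbhs_left_itvoo ac cA.
  exists d, c; split => //.
  near=> x; rewrite /= in_itv/=; apply/andP; split => //.
Unshelve. all: by end_near. Qed.

Lemma one_sided_near a b F : a < b -> one_sided a b F -> F `]a, b[%classic.
Proof.
move=> ab oF; have FF := one_sided_proper oF.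
have [c [d [ac cd db Fcd _]]] := one_sided_itvoo oF (@filterT _ F FF).
by apply: filterS Fcd; apply: subset_itv; rewrite bnd_simp.
Qed.

(* Points close to c on the same side lie on one side of [y, z], which keeps
   the intervals built in [BV_regulated_along] disjoint. *)
Lemma one_sided_shrink a b F : one_sided a b F ->
  exists2 D, F D & forall y z, D y -> D z -> F [set t | t < y] \/ F [set t | z < t].
Proof.
move=> [] [c _ ->].
- exists [set t | c < t]; first exact: nbhs_right_gt.
  by move=> y z cy cz; left; exact: nbhs_right_lt.
- exists [set t | t < c]; first exact: nbhs_left_lt.
  by move=> y z cy cz; right; exact: nbhs_left_gt.
Qed.

Lemma one_sided_split a b c F : a < c -> c <= b -> one_sided a b F ->
  F `]a, c[%classic \/ one_sided c b F.
Proof.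
move=> ac cb [] [d /andP[ad db] ->].
- have [cd|dc] := leP c d; first by right; left; exists d => //; rewrite cd.
  left; apply: (@one_sided_near _ c d^'+ ac).
  by left; exists d => //; rewrite ad.
- have [dc|cd] := leP d c; last by right; right; exists d => //; rewrite cd.
  left; apply: (@one_sided_near _ c d^'- ac).
  by right; exists d => //; rewrite ad.
Qed.

(** A one-sided filter never straddles a breakpoint, so it concentrates on one open cell, found by
    splitting off the first cell repeatedly. *)
Lemma itv_partition_near a b (s : seq R) F : itv_partition a b s ->
  one_sided a b F ->
  exists2 i, (i < size s)%N & F `]nth b (a :: s) i, nth b (a :: s) i.+1[%classic.
Proof.
elim: s a => [|c s ih] a.
  move=> /itv_partition_nil -> [] [d /andP[bd db] _].
    by move: (le_lt_trans bd db); rewrite ltxx.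
  by move: (lt_le_trans bd db); rewrite ltxx.
move=> abs oF; have cbs := itv_partition_cons abs.
have ac : a < c by case: abs => /= /andP[].
have [Fac|/(ih _ cbs)[i si Fi]] := one_sided_split ac (itv_partition_le cbs) oF.
  by exists 0%N.
by exists i.+1.
Qed.

(** The Cauchy condition for u along F within L; naming no limit value, it passes directly to
    uniform limits. *)
Definition small_osc L F u := forall e, 0 < e ->
  exists2 A : set R, F A & forall y z, A y -> A z -> L y -> L z -> `|u y - u z| <= e.

Definition regulated_along a b L u :=
  forall F, one_sided a b F -> small_osc L F u.

Lemma step_function_regulated_along a b w :
  step_function a b w -> regulated_along a b setT w.
Proof.
move=> [_ [s [abs sw]]] F oF e e0.
have [i si Fi] := itv_partition_near abs oF.
have [c wc] := sw i si.
exists `]nth b (a :: s) i, nth b (a :: s) i.+1[%classic => // y z yi zi _ _.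
by rewrite !wc// subrr normr0 ltW.
Qed.

(** If the oscillation exceeded e arbitrarily far along F, each member of F would contain two points
    of L with a jump above e. Retreating to one side of each pair found produces n disjoint pairs,
    hence a variation of at least n e for every n. *)
Lemma BV_regulated_along a b v : a < b -> BV a b v ->
  exists2 L : set R, (\forall x \ae leb R, x \in `]a, b[ -> L x) &
    regulated_along a b L v.
Proof.
move=> ab [/sum_jumps_le_Var[L [aeL jumps]] Vfin].
exists L => // F oF e e0; have FF := one_sided_proper oF.
have [D FD HD] := one_sided_shrink oF.
apply: contrapT => H.
have bad (A : set R) : F A -> exists y z,
    [/\ A y /\ A z, L y /\ L z, y < z & e < `|v y - v z|].
  move=> FA; apply: contrapT => nbad; apply: H; exists A => // y z Ay Az Ly Lz.
  rewrite leNgt; apply/negP => eyz; apply: nbad.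
  have [yz|zy|yz] := ltgtP y z.
  - by exists y, z.
  - by exists z, y; rewrite distrC.
  - by move: eyz; rewrite yz subrr normr0 ltNge ltW.
have many n (A : set R) : F A -> exists p q : 'I_n -> R,
    (forall i, [/\ A (p i) /\ A (q i), L (p i) /\ L (q i), p i < q i
      & e < `|v (p i) - v (q i)|]) /\
    (forall i j, i != j -> q i < p j \/ q j < p i).
  elim: n A => [|n ih] A FA.
    by exists (fun=> 0), (fun=> 0); split => -[].
  have [y [z [[[Ay Dy] [Az Dz]] Lyz yz eyz]]] := bad _ (filterI FA FD).
  have [B FB [BA sepB]] : exists2 B : set R, F B & B `<=` A /\
      ((forall t, B t -> t < y) \/ (forall t, B t -> z < t)).
    have [Fy|Fz] := HD _ _ Dy Dz.
      exists (A `&` [set t | t < y]); first exact: filterI.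
      by split; [exact: subIsetl|left => t []].
    exists (A `&` [set t | z < t]); first exact: filterI.
    by split; [exact: subIsetl|right => t []].
  have [p [q [pqP pqsep]]] := ih B FB.
  (* [ext] puts the endpoint of the new pair at index 0 and shifts the old family by one. *)
  pose ext (f : 'I_n -> R) x i := if unlift ord0 i is Some j then f j else x.
  exists (ext p y), (ext q z); split.
    move=> i; rewrite /ext; case: unliftP => [j|] _; last by split.
    have [[Bp Bq] ? ? ?] := pqP j; split => //.
    by split; apply: BA.
  move=> i j; rewrite /ext; case: unliftP => [i'|] ->; case: unliftP => [j'|] -> //.
  - by move=> ij; apply: pqsep; apply: contra ij => /eqP ->.
  - move=> _; have [[Bp Bq] _ _ _] := pqP i'.
    by case: sepB => sB; [left|right]; exact: sB.
  - move=> _; have [[Bp Bq] _ _ _] := pqP j'.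
    by case: sepB => sB; [right|left]; exact: sB.
have ne n : ((n%:R * e)%:E <= Var a b v)%E.
  have [p [q [pqP pqsep]]] := many n _ (one_sided_near ab oF).
  have H1 i : [/\ a < p i, p i < q i, q i < b, L (p i) & L (q i)].
    have [[/= + +] [? ?] ? _] := pqP i; rewrite !in_itv/=.
    by move=> /andP[? ?] /andP[? ?]; split.
  apply: le_trans (jumps n p q H1 pqsep); rewrite lee_fin.
  rewrite -[X in X%:R](card_ord n) mulr_natl -sumr_const.
  by apply: ler_sum => i _; apply/ltW; have [] := pqP i.
(* A finite value r is refuted by an integer above r / e, and the value -oo by n = 0. *)
move: Vfin ne; case: (Var a b v) => [r| |] // _.
- move=> /(_ (Num.bound `|r / e|)).
  rewrite lee_fin leNgt -ltr_pdivrMr// => /negP; apply.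
  exact: le_lt_trans (ler_norm _) (archi_boundP (normr_ge0 _)).
- by move=> /(_ 0%N).
Qed.

(** An e / 3 argument. The tolerances 1 / (n + 1) reduce the choice to countably many co-null sets,
    whose intersection is again co-null. *)
Lemma unif_limit_regulated_along a b u : a < b ->
  (forall e, 0 < e -> exists v, exists2 L : set R,
    (\forall x \ae leb R, x \in `]a, b[ -> L x /\ `|u x - v x| <= e) &
    regulated_along a b L v) ->
  exists2 L : set R, (\forall x \ae leb R, x \in `]a, b[ -> L x) &
    regulated_along a b L u.
Proof.
move=> ab H.
have /choice[v Hv] n : exists v, exists2 L : set R,
    (\forall x \ae leb R, x \in `]a, b[ -> L x /\ `|u x - v x| <= n.+1%:R^-1) &
    regulated_along a b L v by exact: H.
have /choice[L HL] n : exists L : set R,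
    (\forall x \ae leb R, x \in `]a, b[ -> L x /\ `|u x - v n x| <= n.+1%:R^-1) /\
    regulated_along a b L (v n) by have [L] := Hv n; exists L.
exists [set x | forall n, L n x /\ `|u x - v n x| <= n.+1%:R^-1].
  have /ae_foralln : forall n, \forall x \ae leb R, x \in `]a, b[ ->
    L n x /\ `|u x - v n x| <= n.+1%:R^-1 by move=> n; have [] := HL n.
  by apply: (@filterS _ _ leb_ae_filter) => x /= + xab n; exact.
move=> F oF e e0; have e3 : 0 < e / 3 by rewrite divr_gt0.
have [n ne] : exists n, n.+1%:R^-1 <= e / 3.
  exists (Num.bound (e / 3)^-1).
  rewrite -[leRHS]invrK lef_pV2 ?posrE ?invr_gt0//.
  have e3V : 0 <= (e / 3)^-1 by rewrite invr_ge0 ltW.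
  by rewrite (le_trans (ltW (archi_boundP e3V)))// ler_nat.
have [A FA HA] := (HL n).2 F oF _ e3.
exists A => // y z Ay Az Ly Lz.
have := HA y z Ay Az (Ly n).1 (Lz n).1.
have := (Ly n).2; have := (Lz n).2; move: ne; move: (n.+1%:R^-1) => k ke.
rewrite !ler_norml => /andP[? ?] /andP[? ?] /andP[? ?].
by apply/andP; split; lra.
Qed.

Lemma regulated_along_version a b L u : a < b ->
  (\forall x \ae leb R, x \in `]a, b[ -> L x) -> regulated_along a b L u ->
  exists2 w, (\forall x \ae leb R, x \in `]a, b[ -> w x = u x) &
    regulated_along a b setT w.
Proof.
move=> ab aeL regu.
(* u(x) may be anything off L, so it is replaced there by the right limit of
   u along L *)
have lim_right x : exists r, x \in `]a, b[ ->
    forall e, 0 < e -> exists2 A : set R, x^'+ A &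
      forall y, A y -> L y -> `|r - u y| <= e.
  have [xab|] := boolP (x \in `]a, b[); last by exists 0.
  have oF : one_sided a b x^'+.
    by left; exists x => //; move: xab; rewrite in_itv/= => /andP[/ltW -> ->].
  (* A co-null set meets every subinterval, so [within L x^'+] is proper and the Cauchy condition
     yields a limit. *)
  have meet A : x^'+ A -> exists2 y, A y & L y.
    move=> /(one_sided_itvoo oF)[c [d [ac cd db _ cdA]]].
    by have [y ycd Ly] := conull_itvoo aeL ac cd db; exists y => //; exact: cdA.
  have PF : ProperFilter (u @ within L x^'+).
    apply: fmap_proper_filter; apply: Build_ProperFilter_ex => A wA.
    by have [y Ay Ly] := meet _ wA; exists y; exact: Ay.
  have : cvg (u @ within L x^'+).
    apply: cauchy_cvg; apply: cauchy_exP => e e0.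
    have e2 : 0 < e / 2 by rewrite divr_gt0.
    have [A FA HA] := regu _ oF _ e2.
    have [y Ay Ly] := meet _ FA; exists (u y).
    apply: (@filterS _ x^'+ _ A _ _ FA) => z Az Lz.
    rewrite -ball_normE /ball_/=; apply: le_lt_trans (HA y z Ay Az Ly Lz) _.
    by rewrite ltr_pdivrMr// ltr_pMr// ltr1n.
  move=> /cvg_ex[r ur]; exists r => _ e e0.
  exists [set y | L y -> `|r - u y| <= e]; last by move=> y Ay Ly; exact: Ay.
  by move/cvgrPdist_le : ur => /(_ _ e0).
have [r Hr] := choice lim_right.
pose w x := if x \in L then u x else r x.
have wL x : L x -> w x = u x by move=> Lx; rewrite /w mem_set.
exists w.
  by move: aeL; apply: (@filterS _ _ leb_ae_filter) => x /= /[apply]; exact: wL.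
move=> F oF e e0; have e2 : 0 < e / 4 by rewrite divr_gt0.
have [A FA HA] := regu _ oF _ e2.
have [c [d [ac cd db Fcd cdA]]] := one_sided_itvoo oF FA.
exists `]c, d[%classic => // y z ycd zcd _ _.
have [t tcd Lt] := conull_itvoo aeL ac cd db.
(* Off L, w x is compared with u t through a point y' of L just to the right of x: e / 4 from r x to
   u y' and e / 4 from u y' to u t. Using [close] at y and at z then gives e. *)
have close x : x \in `]c, d[ -> `|w x - u t| <= e / 2.
  move=> xcd; have [Lx|nLx] := pselect (L x).
    rewrite wL//; apply: le_trans (HA x t (cdA _ xcd) (cdA _ tcd) Lx Lt) _; lra.
  rewrite /w memNset//.
  have xab : x \in `]a, b[ by apply: subset_itv xcd; rewrite bnd_simp.
  have [B xB HB] := Hr x xab _ e2.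
  have oFx : one_sided c d x^'+.
    by left; exists x => //; move: xcd; rewrite in_itv/= => /andP[/ltW -> ->].
  have FFx := one_sided_proper oFx.
  have [c' [d' [cc' cd' dd' _ H]]] :=
    one_sided_itvoo oFx (filterI xB (one_sided_near cd oFx)).
  have [y' ycd' Ly'] := conull_itvoo aeL (le_trans ac cc') cd' (le_trans dd' db).
  have [By' ycd''] := H _ ycd'.
  have := HB _ By' Ly'; have := HA y' t (cdA _ ycd'') (cdA _ tcd) Ly' Lt.
  rewrite !ler_norml => /andP[? ?] /andP[? ?].
  by apply/andP; split; lra.
have := close y ycd; have := close z zcd.
rewrite !ler_norml => /andP[? ?] /andP[? ?].
by apply/andP; split; lra.
Qed.

End one_sided_filters.

(** * Uniform approximation of regulated functions by step functions *)

Section step_approximation.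
Context {R : realType}.
Implicit Types (a b c d e : R) (s : seq R) (w g : R -> R).

Definition osc_le w e c d :=
  forall y z, y \in `]c, d[ -> z \in `]c, d[ -> `|w y - w z| <= e.

Lemma osc_le_itv w e c d c' d' : c <= c' -> d' <= d ->
  osc_le w e c d -> osc_le w e c' d'.
Proof.
move=> cc dd H y z yc zc; apply: H.
  by apply: subset_itv yc; rewrite bnd_simp.
by apply: subset_itv zc; rewrite bnd_simp.
Qed.

Definition osc_partition w e c b s := itv_partition c b s /\
  forall i, (i < size s)%N -> osc_le w e (nth b (c :: s) i) (nth b (c :: s) i.+1).

Lemma osc_partition_cons w e c d b s : c < d -> osc_le w e c d ->
  osc_partition w e d b s -> osc_partition w e c b (d :: s).
Proof.
move=> cd oscd [[ds lasts] oscs]; split.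
  by split => //=; rewrite cd.
by case => [|i] //=; exact: oscs.
Qed.

Lemma regulated_along_osc_partition w e a b : a < b ->
  regulated_along a b setT w -> 0 < e -> exists s, osc_partition w e a b s.
Proof.
move=> ab regw e0.
have rightP m : a <= m -> m < b -> exists d, [/\ m < d, d <= b & osc_le w e m d].
  move=> am mb; have oF : one_sided a b m^'+ by left; exists m => //; rewrite am.
  have [A FA HA] := regw _ oF _ e0.
  have [d [md db dA]] := nbhs_right_itvoo mb FA.
  by exists d; split => // y z yd zd; apply: HA => //; exact: dA.
have leftP m : a < m -> m <= b -> exists c, [/\ a <= c, c < m & osc_le w e c m].
  move=> am mb; have oF : one_sided a b m^'- by right; exists m => //; rewrite am.
  have [A FA HA] := regw _ oF _ e0.
  have [c [ac cm cA]] := nbhs_left_itvoo am FA.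
  by exists c; split => // y z yd zd; apply: HA => //; exact: cA.
(* the infimum of the left ends of good partitions is attained and equals a *)
pose S := [set c | a <= c < b /\ exists s, osc_partition w e c b s].
have [c0 [ac0 c0b osc0]] := leftP b ab (lexx _).
have Sc0 : S c0.
  split; first by rewrite ac0.
  by exists [:: b]; split; [exact: itv_partition1|case].
have lbS : lbound S a by move=> c [/andP[]].
have infS : has_inf S by split; [exists c0|exists a].
have aS : a <= inf S by apply: lb_le_inf => //; exists c0.
have Sb : inf S < b by apply: le_lt_trans c0b; apply: ge_inf => //; exists a.
(* Some c in S lies in a right neighbourhood of inf S with small oscillation, so at most one further
   cell extends a partition of [c, b] down to inf S. *)
have [d [Sd db oscd]] := rightP _ aS Sb.
have [c Sc cd] := inf_lt infS.1 Sd.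
have [s Hs] : exists s, osc_partition w e (inf S) b s.
  have Sc' : inf S <= c by apply: ge_inf => //; exists a.
  have [_ [s Hs]] := Sc.
  move: Sc'; rewrite le_eqVlt => /predU1P[->|Sc']; first by exists s.
  exists (c :: s); apply: osc_partition_cons => //.
  by apply: osc_le_itv oscd => //; exact: ltW.
(* If a < inf S, one more cell to the left of inf S would produce an element of S below its
   infimum. *)
move: (aS); rewrite le_eqVlt => /predU1P[->|aS']; first by exists s.
have [c' [ac' c'S osc']] := leftP _ aS' (ltW Sb).
have : inf S <= c'.
  apply: ge_inf; first by exists a.
  split; first by rewrite ac' (lt_trans c'S).
  by exists (inf S :: s); exact: osc_partition_cons.
by rewrite leNgt c'S.
Qed.

(** On each open cell g takes the value of w at the midpoint. At the breakpoints, which the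
    oscillation bounds on open cells do not reach, g copies w. *)
Lemma osc_partition_step w e c b s : 0 <= e -> osc_partition w e c b s -> exists g,
  [/\ bounded_on_itv c b g,
      forall i, (i < size s)%N -> exists k, forall x,
        x \in `]nth b (c :: s) i, nth b (c :: s) i.+1[ -> g x = k
    & forall x, x \in `]c, b[ -> `|w x - g x| <= e].
Proof.
move=> e0; elim: s c => [|d s ih] c [cs oscs].
  have {cs} -> := itv_partition_nil cs.
  have bbF x : x \in `]b, b[ -> False by rewrite in_itv/= lt_asym.
  by exists (fun=> 0); split => //; [exists 0 => x /bbF|move=> x /bbF].
have ds := itv_partition_cons cs.
have cd : c < d by case: cs => /= /andP[].
have Hd : osc_partition w e d b s by split => // i si; exact: (oscs i.+1).
have [g' [[M gM] gs gw]] := ih d Hd.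
pose m := (c + d) / 2.
have mcd : m \in `]c, d[ by rewrite in_itv/= /m midf_lt//= midf_lt.
pose g x := if x < d then w m else if x == d then w d else g' x.
exists g; split.
(* The absolute value of M is taken because M may be negative when no point lies beyond d. *)
- exists (`|w m| + `|w d| + `|M|) => x; rewrite in_itv/= => /andP[cx xb].
  have := normr_ge0 (w m); have := normr_ge0 (w d); have := normr_ge0 M.
  rewrite /g; have [xd|dx|_] := ltgtP x d; [lra| |lra].
  have : `|g' x| <= M by apply: gM; rewrite in_itv/= dx.
  have := ler_norm M; lra.
- case => [_|i si]; first by exists (w m) => x /=; rewrite in_itv/= /g => /andP[_ ->].
  have [k Hk] := gs i si; exists k => x xi; rewrite /g.
  have dx : d < x.
    have dn : d <= nth b (d :: s) i by apply: itv_partition_nth_ge => //; exact: leqW.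
    by apply: (le_lt_trans dn); move: xi; rewrite in_itv => /andP[].
  by rewrite ltNge ltW//= gt_eqF//; exact: Hk.
- move=> x; rewrite in_itv/= => /andP[cx xb].
  rewrite /g; have [xd|dx|->] := ltgtP x d; last by rewrite subrr normr0.
    by apply: (oscs 0%N) => //=; rewrite in_itv/= cx.
  by apply: gw; rewrite in_itv/= dx.
Qed.

Lemma regulated_along_step w e a b : a < b -> regulated_along a b setT w ->
  0 < e -> exists2 g, step_function a b g &
    forall x, x \in `]a, b[ -> `|w x - g x| <= e.
Proof.
move=> ab regw e0.
have [s Hs] := regulated_along_osc_partition ab regw e0.
have [g [gM gs gw]] := osc_partition_step (ltW e0) Hs.
by exists g => //; split => //; exists s; split => //; have [] := Hs.
Qed.

(** By completeness of the reals, the Cauchy condition along a one-sided filter amounts to the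
    existence of the limit. Boundedness follows from a step function at distance at most 1. *)
Lemma regulatedP w a b : a < b ->
  regulated a b w <-> regulated_along a b setT w.
Proof.
move=> ab; split.
  move=> [_ regw ra rb] F oF.
  have : cvg (w @ F).
    case: oF => [] [c /andP[ac cb] ->].
      move: ac; rewrite le_eqVlt => /predU1P[<-|ac]; first exact: ra.
      by apply: (regw c _).1; rewrite in_itv/= ac.
    move: cb; rewrite le_eqVlt => /predU1P[->|cb]; first exact: rb.
    by apply: (regw c _).2; rewrite in_itv/= ac.
  have FF := one_sided_proper oF.
  move=> /cvg_ex[l /cvgrPdist_le wl] e e0.
  have e2 : 0 < e / 2 by rewrite divr_gt0.
  exists [set x | `|l - w x| <= e / 2]; first exact: wl.
  move=> y z /=; rewrite !ler_norml => /andP[? ?] /andP[? ?] _ _.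
  by apply/andP; split; lra.
move=> regw.
have cvgF F : one_sided a b F -> cvg (w @ F).
  move=> oF; have FF := one_sided_proper oF.
  apply: cauchy_cvg; apply: cauchy_exP => e e0.
  have e2 : 0 < e / 2 by rewrite divr_gt0.
  have [A FA HA] := regw _ oF _ e2.
  have [y Ay] := filter_ex FA; exists (w y).
  apply: (@filterS _ F _ A _ _ FA) => z Az.
  rewrite -ball_normE /ball_/=; apply: le_lt_trans (HA y z Ay Az I I) _.
  by rewrite ltr_pdivrMr// ltr_pMr// ltr1n.
split.
- have [g [[M gM] _] gw] := regulated_along_step ab regw ltr01.
  exists (M + 1) => x xab; have := gM x xab; have := gw x xab.
  rewrite !ler_norml => /andP[? ?] /andP[? ?].
  by apply/andP; split; lra.
- move=> x; rewrite in_itv/= => /andP[ax xb]; split; apply: cvgF.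
    by left; exists x => //; rewrite (ltW ax).
  by right; exists x => //; rewrite (ltW xb) ax.
- by apply: cvgF; left; exists a => //; rewrite lexx.
- by apply: cvgF; right; exists b => //; rewrite lexx ab.
Qed.

End step_approximation.

(** * Measurability and finite variation of step functions *)

Section step_functions.
Context {R : realType}.
Local Notation mu := (@lebesgue_measure R).
Implicit Types (a b c d e k : R) (s : seq R) (g u v w phi : R -> R).

Lemma partition_measurable c b s g : itv_partition c b s ->
  (forall i, (i < size s)%N -> exists k, forall x,
     x \in `]nth b (c :: s) i, nth b (c :: s) i.+1[ -> g x = k) ->
  measurable_fun `]c, b[ g.
Proof.
elim: s c => [|d s ih] c cs gs.
  rewrite (itv_partition_nil cs) set_itvoo0//; exact: measurable_fun_set0.
have [k gk] := gs 0%N isT.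
have md : measurable_fun `]d, b[ g.
  by apply: ih (itv_partition_cons cs) _ => i si; exact: (gs i.+1).
have mc : measurable_fun `]c, d[ g.
  apply: (@eq_measurable_fun _ _ _ _ _ (cst k)) => // x; rewrite inE => xcd.
  by rewrite /= gk.
apply: (@measurable_funS _ _ _ _ ((`]c, d[ `|` [set d]) `|` `]d, b[)).
- by apply: measurableU => //; exact: measurableU.
- move=> x /=; rewrite !in_itv/= => /andP[cx xb].
  by have [xd|dx|xd] := ltgtP x d; [left; left; rewrite cx|right|left; right].
- apply/measurable_funU => //; first exact: measurableU.
  by split => //; apply/measurable_funU => //; split => //; exact: measurable_fun_set1.
Qed.

Lemma step_function_measurable a b g :
  step_function a b g -> measurable_fun `]a, b[ g.
Proof. by move=> [_ [s [abs gs]]]; exact: partition_measurable gs. Qed.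

Lemma bounded_measurable_integrable a b w : bounded_on_itv a b w ->
  measurable_fun `]a, b[ w -> mu.-integrable `]a, b[ (EFin \o w).
Proof.
move=> [M wM] mw; apply: (@measurable_bounded_integrable _ _ _ mu) => //.
  change (mu `]a, b[%classic < +oo)%E; rewrite lebesgue_measure_itv/=.
  by case: ifPn => _; rewrite -?EFinB ltry.
exists M; split; first exact: num_real.
by move=> N MN x xab; exact: le_trans (wM x xab) (ltW MN).
Qed.

Lemma bounded_measurable_L1 a b w : bounded_on_itv a b w ->
  measurable_fun `]a, b[ w -> L1 a b w.
Proof.
move=> bw mw; apply/leb_integrable => //; first exact/measurable_EFinP.
exact: bounded_measurable_integrable.
Qed.

Lemma FTC_itvoo phi c d : c < d -> (forall x, derivable phi x 1) ->
  continuous phi^`()%classic ->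
  mu.-integrable `]c, d[ (EFin \o phi^`()%classic) /\
  \int[mu]_(x in `]c, d[) phi^`()%classic x = phi d - phi c.
Proof.
move=> cd dphi cphi'.
have icd : mu.-integrable `[c, d] (EFin \o phi^`()%classic).
  apply: continuous_compact_integrable; first exact: segment_compact.
  exact: continuous_subspaceT.
have i1 : mu.-integrable `]c, d] (EFin \o phi^`()%classic).
  by apply: integrableS icd => //; exact: subset_itv_oc_cc.
have i2 : mu.-integrable `]c, d[ (EFin \o phi^`()%classic).
  by apply: integrableS icd => //; exact: subset_itv_oo_cc.
have cphi : continuous phi.
  by move=> x; apply/differentiable_continuous/derivable1_diffP.
split => //; rewrite Rintegral_itv_bndo_bndc// Rintegral_itv_obnd_cbnd//.
rewrite /Rintegral (continuous_FTC2 (F := phi) cd).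
- by [].
- exact: continuous_subspaceT.
- split => //; first by apply: cvg_at_right_filter; exact: cphi.
  by apply: cvg_at_left_filter; exact: cphi.
- by [].
Qed.

(** On a cell ]c, d[ where g = k the integral is k (phi d - phi c), at most 2 |k|. Summing over the
    cells gives a K independent of phi. *)
Lemma partition_integral_bound c b s g : itv_partition c b s ->
  (forall i, (i < size s)%N -> exists k, forall x,
     x \in `]nth b (c :: s) i, nth b (c :: s) i.+1[ -> g x = k) ->
  exists K, forall phi, (forall x, derivable phi x 1) ->
    continuous phi^`()%classic -> (forall x, `|phi x| <= 1) ->
    mu.-integrable `]c, b[ (EFin \o (fun x => g x * phi^`()%classic x)) ->
    \int[mu]_(x in `]c, b[) (g x * phi^`()%classic x) <= K.
Proof.
elim: s c => [|d s ih] c cs gs.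
  exists 0 => phi _ _ _ _.
  by rewrite (itv_partition_nil cs) set_itvoo0// Rintegral_set0.
have [k gk] := gs 0%N isT.
have cd : c < d by case: cs => /= /andP[].
have ds := itv_partition_cons cs.
have cell phi : (forall x, derivable phi x 1) ->
    continuous phi^`()%classic -> (forall x, `|phi x| <= 1) ->
    \int[mu]_(x in `]c, d[) (g x * phi^`()%classic x) <= 2 * `|k|.
  move=> dphi cphi phi1; have [iphi Iphi] := FTC_itvoo cd dphi cphi.
  rewrite (@eq_Rintegral _ _ _ mu _ (fun x => k * phi^`()%classic x)); last first.
    by move=> x; rewrite inE => xcd; rewrite gk.
  rewrite RintegralZl// Iphi; have := phi1 d; have := phi1 c.
  rewrite !ler_norml => /andP[? ?] /andP[? ?].
  by have [?|?] := ger0P k; nra.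
(* The last cell is handled apart, since splitting the integral at d uses d < b. *)
have [db|db] := eqVneq d b.
  exists (2 * `|k|) => phi dphi cphi phi1 _.
  by rewrite -db; exact: cell.
have {db} ltdb : d < b by rewrite lt_neqAle db (itv_partition_le ds).
have [|K HK] := ih d ds; first by move=> i si; exact: (gs i.+1).
exists (2 * `|k| + K) => phi dphi cphi phi1 iphi.
have idb : mu.-integrable `]d, b[ (EFin \o (fun x => g x * phi^`()%classic x)).
  by apply: integrableS iphi => //; apply: subset_itv; rewrite bnd_simp// ltW.
have icd : mu.-integrable `]c, d[ (EFin \o (fun x => g x * phi^`()%classic x)).
  by apply: integrableS iphi => //; apply: subset_itv; rewrite bnd_simp// ltW.
have := @Rintegral_itvB _ _ (BRight c) (BLeft b) d iphi.
rewrite !bnd_simp => /(_ (ltW cd) ltdb) /eqP; rewrite subr_eq => /eqP ->.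
rewrite addrC -Rintegral_itv_bndo_bndc//.
by apply: lerD; [exact: cell|exact: HK].
Qed.

(** By continuity, a value above 1 in absolute value would persist on an interval to the right,
    which a co-null set must meet. Outside []a, b[] phi vanishes. *)
Lemma test_function_le1 a b phi : a < b -> Cc1 a b phi ->
  (Linfty_norm a b phi <= 1)%E -> forall x, `|phi x| <= 1.
Proof.
move=> ab [dphi _ _ sphi] /(Linfty_norm_leP _ _ _ ler01) aephi x.
have [phix0|phix] := eqVneq (phi x) 0; first by rewrite phix0 normr0.
have xab : x \in `]a, b[ by apply: sphi; apply: subset_closure.
have cphi : {for x, continuous (fun t => `|phi t|)}.
  apply: cvg_norm; exact/differentiable_continuous/derivable1_diffP.
rewrite leNgt; apply/negP => phi1.
have near1 : \forall t \near x^'+, 1 < `|phi t|.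
  by apply: cvg_within; exact: (cvgr_gt _ cphi).
have oF : one_sided a b x^'+.
  by left; exists x => //; move: xab; rewrite in_itv/= => /andP[/ltW -> ->].
have [c [d [ac cd db _ H]]] := one_sided_itvoo oF near1.
have [t tcd /=] := conull_itvoo aephi ac cd db.
have tab : t \in `]a, b[ by apply: subset_itv tcd; rewrite bnd_simp.
by rewrite leNgt H.
Qed.

Lemma step_function_BV a b g : a < b -> step_function a b g -> BV a b g.
Proof.
move=> ab sg; have mg := step_function_measurable sg.
have [bg [s [abs gs]]] := sg.
split; first exact: bounded_measurable_L1.
have [K HK] := partition_integral_bound abs gs.
apply: (@le_lt_trans _ _ K%:E); last exact: ltry.
apply: ge_ereal_sup => _ [phi [Cphi phi1] <-].
have phile := test_function_le1 ab Cphi phi1.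
have [dphi cphi _ _] := Cphi.
have mphi : measurable_fun setT phi^`()%classic.
  exact: continuous_measurable_fun.
have [iphi _] := FTC_itvoo ab dphi cphi.
rewrite leb_integral//; last first.
  apply/measurable_EFinP; apply: measurable_funM => //.
  exact: measurable_funTS.
have ig : mu.-integrable `]a, b[ (EFin \o (fun x => g x * phi^`()%classic x)).
  have [M gM] := bg.
  apply: (@integrableMr _ _ _ mu `]a, b[ _ g (EFin \o phi^`()%classic)) => //.
  exists M; split; first exact: num_real.
  by move=> N MN x xab; exact: le_trans (gM x xab) (ltW MN).
have := HK phi dphi cphi phile ig.
by rewrite -lee_fin /Rintegral fineK//; exact: integrable_fin_num.
Qed.

End step_functions.

(** * The implications between the three conditions *)

Section equivalence.
Context {R : realType}.
Implicit Types (a b e : R) (L : set R) (u v w : R -> R).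

(** A finite infimum provides, for each e, some v in [BV] at essential distance at most e from u, so
    u is a uniform limit of such v. *)
Lemma infty_regulated_along a b u : a < b -> infty_regulated a b u ->
  exists2 L : set R, (\forall x \ae leb R, x \in `]a, b[ -> L x) &
    regulated_along a b L u.
Proof.
move=> ab [_ uV]; apply: unif_limit_regulated_along => // e e0.
have /ereal_inf_lt[_ [v [BVv uv] _] _] := uV e e0.
have [L aeL regv] := BV_regulated_along ab BVv.
exists v, L => //; have /(Linfty_norm_leP _ _ _ (ltW e0)) aeuv := uv.
move: aeL aeuv; apply: (@filterS2 _ _ leb_ae_filter) => x Lx uvx xab.
by split; [exact: Lx|exact: uvx].
Qed.

Lemma step_limit_along a b u : a < b -> step_limit a b u ->
  exists2 L : set R, (\forall x \ae leb R, x \in `]a, b[ -> L x) &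
    regulated_along a b L u.
Proof.
move=> ab [un [sun]] /fine_cvgP[finun cvgun].
apply: unif_limit_regulated_along => // e e0.
have [n [finn une]] : exists n, Linfty_norm a b (u \- un n) \is a fin_num /\
    `|0 - fine (Linfty_norm a b (u \- un n))| <= e.
  move/cvgrPdist_le : cvgun => /(_ _ e0) cvgun.
  have := filter_ex (filterI finun cvgun).
  by move=> [n [? ?]]; exists n.
exists (un n), setT; last exact: step_function_regulated_along.
have : (Linfty_norm a b (u \- un n)%R <= e%:E)%E.
  rewrite -(fineK finn) lee_fin; apply: le_trans une.
  by rewrite sub0r normrN ler_norm.
move=> /(Linfty_norm_leP _ _ _ (ltW e0)).
by apply: (@filterS _ _ leb_ae_filter) => x /= H xab; split => //; exact: H.
Qed.

Lemma along_has_regulated_version a b u L : a < b ->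
  (\forall x \ae leb R, x \in `]a, b[ -> L x) -> regulated_along a b L u ->
  has_regulated_version a b u.
Proof.
move=> ab aeL regu; have [w wu regw] := regulated_along_version ab aeL regu.
by exists w; split => //; exact/regulatedP.
Qed.

Lemma regulated_steps a b w : a < b -> regulated a b w ->
  exists g : nat -> R -> R, (forall n, step_function a b (g n)) /\
    forall n x, x \in `]a, b[ -> `|w x - g n x| <= n.+1%:R^-1.
Proof.
move=> ab /(regulatedP _ ab) regw.
have /choice[g Hg] n : exists g, step_function a b g /\
    forall x, x \in `]a, b[ -> `|w x - g x| <= n.+1%:R^-1.
  have n0 : 0 < n.+1%:R^-1 :> R by rewrite invr_gt0.
  by have [g sg gw] := regulated_along_step ab regw n0; exists g.
by exists g; split => n; have [] := Hg n.
Qed.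

Lemma version_Linfty_le a b u w g e : 0 <= e ->
  (\forall x \ae leb R, x \in `]a, b[ -> w x = u x) ->
  (forall x, x \in `]a, b[ -> `|w x - g x| <= e) ->
  (Linfty_norm a b (u \- g)%R <= e%:E)%E.
Proof.
move=> e0 wu wg; apply/Linfty_norm_leP => //.
by move: wu; apply: (@filterS _ _ leb_ae_filter) => x /= wu xab;
  rewrite -wu//; exact: wg.
Qed.

Lemma has_regulated_version_step_limit a b u : a < b ->
  has_regulated_version a b u -> step_limit a b u.
Proof.
move=> ab [w [regw wu]]; have [g [sg gw]] := regulated_steps ab regw.
exists g; split => //.
have inv0 : (n.+1%:R^-1)%:E @[n --> \oo] --> (0 : R)%:E.
  by apply: cvg_EFin; [exact: nearW|exact: cvg_harmonic].
apply: (squeeze_cvge _ (cvg_cst 0%E) inv0).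
near=> n; apply/andP; split; first exact: Lnorm_ge0.
exact: (version_Linfty_le _ wu (gw n)).
Unshelve. all: by end_near. Qed.

(** Such a w is a pointwise limit of measurable step functions. *)
Lemma regulated_measurable a b w : a < b -> regulated a b w ->
  measurable_fun `]a, b[ w.
Proof.
move=> ab regw; have [g [sg gw]] := regulated_steps ab regw.
apply: (@measurable_fun_cvg _ _ _ _ g).
  by move=> n; exact: step_function_measurable.
move=> x xab; apply/cvgrPdist_le => e e0.
near=> n; apply: le_trans (gw n x xab) _.
by apply/ltW; near: n; exact: (near_infty_natSinv_lt (PosNum e0)).
Unshelve. all: by end_near. Qed.

(** Measurability passes from w to u because the measure is complete; this is where the completed
    measure in [L1] matters. *)
Lemma ae_eq_L1 a b u w : (\forall x \ae leb R, x \in `]a, b[ -> w x = u x) ->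
  L1 a b w -> L1 a b u.
Proof.
move=> wu /integrableP[mw iw].
have wuE : {ae leb R, forall x, `]a, b[%classic x -> (EFin \o w) x = (EFin \o u) x}.
  by move: wu; apply: (@filterS _ _ leb_ae_filter) => x /= /[apply] ->.
have mu' := ae_measurable_fun completed_lebesgue_measure_is_complete wuE mw.
apply/integrableP; split => //; apply: le_lt_trans iw.
rewrite le_eqVlt; apply/orP; left; apply/eqP; apply: leb_ae_eq_integral.
- exact: (leb_measurable (measurable_itv _)).
- exact: measurableT_comp.
- exact: measurableT_comp.
- by move: wu; apply: (@filterS _ _ leb_ae_filter) => x /= /[apply] ->.
Qed.

(** A step function within e of the regulated version has finite variation and competes in the
    infimum. *)
Lemma has_regulated_version_infty_regulated a b u : a < b ->
  has_regulated_version a b u -> infty_regulated a b u.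
Proof.
move=> ab [w [regw wu]]; split.
  apply: (ae_eq_L1 wu); apply: bounded_measurable_L1; first by case: regw.
  exact: regulated_measurable.
move=> e e0; have [g sg gw] := regulated_along_step ab ((regulatedP _ ab).1 regw) e0.
have BVg := step_function_BV ab sg.
apply: le_lt_trans BVg.2; apply: ereal_inf_lbound; exists g => //.
by split => //; exact: (version_Linfty_le (ltW e0) wu gw).
Qed.

End equivalence.
Unset Implicit Arguments.

Theorem proposition3p20 (R : realType) (a b : R) (hab : a < b) (u : R -> R) :
  (infty_regulated a b u <-> step_limit a b u) /\
  (step_limit a b u <-> has_regulated_version a b u).
Proof.
(* The regulated version serves as the hub: it follows from either of the other conditions and
   implies both. *)
have ac : infty_regulated a b u -> has_regulated_version a b u.
  by move=> /(infty_regulated_along hab)[L]; exact: along_has_regulated_version.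
have bc : step_limit a b u -> has_regulated_version a b u.
  by move=> /(step_limit_along hab)[L]; exact: along_has_regulated_version.
have cb := @has_regulated_version_step_limit _ _ _ u hab.
have ca := @has_regulated_version_infty_regulated _ _ _ u hab.
by split; split => // [/ac/cb|/bc/ca].
Qed.
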